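(* Let $(G,f,h)$ be a finite-state time-weighted automaton over $\Sigma$, $E\subseteq\Sigma^*$, and $\mathcal{E}_T=\{(E_i,d_i)\mid i\in I\}$ a finite set of job requirements with deadlines such that $\Sigma=\bigcup_{i\in I}\Sigma_i$. Suppose $K:=\sup\mathcal{C}(G,f,h,E,\mathcal{E}_T)\neq\varnothing$. For each $L\in\mathbf{CL}(K)$ consider the optimization problem $$\min_{D\in\mathbf{DC}}\ \max_{s\in L} e_{f+D}(s)\quad\text{subject to}\quad t_{E_i,f+D}(s)\le d_i\ \text{ for all } s\in L,\ i\in I,$$ let $e^*(L)$ be its optimal value and $\mathbf{DC}^*(L)$ its set of optimal solutions. Let $\mathbf{OL}=\{L\in\mathbf{CL}(K)\mid \forall L'\in\mathbf{CL}(K),\ e^*(L)\le e^*(L')\}$ and $\mathbf{DC}^*=\bigcup_{L\in\mathbf{OL}}\mathbf{DC}^*(L)$. Then computing $\mathbf{DC}^*$ solves the minimum-earliness delay problem: $\mathbf{DC}^*$ is nonempty, and every $D^*\in\mathbf{DC}^*$ satisfies $\sup\mathcal{C}(G,f+D^*,h,E,\mathcal{E}_T)\ne\varnothing$ and $$e_{f+D^*}\big(\sup\mathcal{CF}(G,f+D^*,h,E,\mathcal{E}_T)\big)=\min_{D\in\mathbf{DC}} e_{f+D}\big(\sup\mathcal{CF}(G,f+D,h,E,\mathcal{E}_T)\big),$$ where the minimum on the right is over those $D\in\mathbf{DC}$ with $\sup\mathcal{C}(G,f+D,h,E,\mathcal{E}_T)\neq\varnothing$.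
   Context: **Time-weighted automaton.** $G=(X,\Sigma,\xi,x_0,X_m)$ is a deterministic finite automaton with partial transition function $\xi$. $L(G)=\{s\in\Sigma^*\mid \xi(x_0,s)\text{ is defined}\}$ is its closed behavior and $L_m(G)=\{s\in L(G)\mid \xi(x_0,s)\in X_m\}$ its marked behavior. $\mathcal{T}=\{(x,\sigma)\in X\times\Sigma\mid \xi(x,\sigma)\text{ is defined}\}$ is the set of transitions. $f:\mathcal{T}\to\mathbb{R}^+$ (positive reals) gives the duration of each transition. $h\subseteq\Sigma\times\Sigma$ is a reflexive and symmetric mutual exclusion relation. The triple $(G,f,h)$ is a finite-state time-weighted automaton. The alphabet is a disjoint union $\Sigma=\Sigma_c\,\dot\cup\,\Sigma_{uc}$ of controllable and uncontrollable events. **Execution time.** The relation $h$ induces a finite nonempty resource set $\mathcal{R}$ and a map $R:\mathcal{T}\to 2^{\mathcal{R}}$, where $R(x,\sigma)$ depends only on $\sigma$ and $R(x,\sigma)\cap R(x',\sigma')\neq\varnothing$ iff $(\sigma,\sigma')\in h$. Put $n_h=|\mathcal{R}|$. For a weight function $g:\mathcal{T}\to\mathbb{R}^+$ and $\tau\in\mathcal{T}$, $\hat{\mathcal{M}}_{G,g,h}(\tau)$ is the $n_h\times n_h$ matrix over the max-plus semiring $\mathbb{R}_{max}=\mathbb{R}\cup\{-\infty\}$ whose $(q,v)$ entry is $0$ if ($q=v$ and $q\notin R(\tau)$) or ($q\in R(\tau)$ and $v\notin R(\tau)$); is $g(\tau)$ if $q,v\in R(\tau)$; and is $-\infty$ otherwise.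 Extend to a morphism on $\mathcal{T}^*$ by max-plus matrix multiplication, with $\epsilon$ mapped to the max-plus identity. For $s\in L(G)$ let $\varpi(s)\in\mathcal{T}^*$ be the sequence of transitions executed by $s$ from $x_0$. The execution time is $\upsilon_g(s)=\mathbf{1}^t\hat{\mathcal{M}}_{G,g,h}(\varpi(s))\mathbf{1}$ in max-plus algebra with $\mathbf{1}$ the all-zero column vector, i.e. the maximum entry of $\hat{\mathcal{M}}_{G,g,h}(\varpi(s))$. **Jobs.** $I$ is a finite index set. For $i\in I$: $\Sigma_i\subseteq\Sigma$, $E_i\subseteq\Sigma_i^*$ is a regular language, $d_i\in\mathbb{R}^+$ is its deadline, and $P_i:\Sigma^*\to\Sigma_i^*$ is the natural projection. For $s\in L(G)$, $t_{E_i,g}(s)=\min\{\upsilon_g(s')\mid s'\text{ a prefix of }s,\ P_i(s')=P_i(s)\}$, i.e. the execution time of the prefix of $s$ ending at the last event of $s$ in $\Sigma_i$ (and $0$ if there is none). $W_g(\mathcal{E}_T)$ is the set of strings $s$ with $P_i(s)\in E_i$ and $t_{E_i,g}(s)\le d_i$ for all $i\in I$ (only its intersection with $L_m(G)$ is used). **Controllability.** $K\subseteq L_m(G)$ is controllable w.r.t. $G$ if $\overline{K}\Sigma_{uc}\cap L(G)\subseteq\overline{K}$, where $\overline{K}$ is the prefix closure. $\mathcal{C}(G,g,h,E,\mathcal{E}_T)$ is the collection of all $K\subseteq L_m(G)\cap E\cap W_g(\mathcal{E}_T)$ controllable w.r.t. $G$, and $\sup\mathcal{C}(G,g,h,E,\mathcal{E}_T)$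 is its largest element under inclusion. **Earliness.** For $s\in W_g(\mathcal{E}_T)$, $e_g(s)=\sum_{i\in I}(d_i-t_{E_i,g}(s))$. For a finite language $K\subseteq W_g(\mathcal{E}_T)$, $e_g(K)=\max_{s\in K}e_g(s)$, with $e_g(\varnothing)=0$. **Delays.** $\mathbf{DC}$ is the set of functions $D:\mathcal{T}\to\mathbb{R}^+\cup\{0\}$ with $D(x,\sigma)=0$ whenever $\sigma\in\Sigma_{uc}$. For $D\in\mathbf{DC}$, $(f+D)(x,\sigma)=f(x,\sigma)+D(x,\sigma)$. **Supremal minimum-earliness sublanguage.** If $\sup\mathcal{C}(G,f+D,h,E,\mathcal{E}_T)\neq\varnothing$, then $\sup\mathcal{CF}(G,f+D,h,E,\mathcal{E}_T)$ denotes the (unique) nonempty $\hat K_*\in\mathcal{C}(G,f+D,h,E,\mathcal{E}_T)$ such that every nonempty $K\in\mathcal{C}(G,f+D,h,E,\mathcal{E}_T)$ satisfies $e_{f+D}(\hat K_* )\le e_{f+D}(K)$, and $e_{f+D}(K)=e_{f+D}(\hat K_* )$ implies $K\subseteq\hat K_*$. Whenever this notation is used, $\sup\mathcal{C}(G,f+D,h,E,\mathcal{E}_T)\ne\varnothing$ is implicitly assumed. **Minimal controllable sublanguages.** For $K\subseteq L_m(G)$ finite and nonempty, $\mathbf{CL}(K)$ is the collection of all nonempty sublanguages $K_1\subseteq K$ that are controllable w.r.t. $G$ and minimal: for every nonempty controllable $K_2\subseteq K$, $K_2\subseteq K_1$ implies $K_2=K_1$. *)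

(* Defs.v *)
From HB Require Import structures.
From mathcomp Require Import all_boot all_order all_algebra.
From mathcomp Require Import boolp classical_sets reals constructive_ereal.

Set Implicit Arguments.
Unset Strict Implicit.
Unset Printing Implicit Defensive.

Import Order.TTheory GRing.Theory Num.Theory.

Local Open Scope classical_set_scope.
Local Open Scope ring_scope.

Section Automata.
Context {Sigma : finType}.

Record automaton := Automaton {
  state : finType;
  delta : state -> Sigma -> option state;
  init : state;
  marked : {set state} }.

Fixpoint run (G : automaton) (x : state G) (s : seq Sigma) : option (state G) :=
  if s is a :: s' then obind (fun y => run y s') (delta x a) else Some x.

Definition closed_behavior (G : automaton) : set (seq Sigma) :=
  [set s | isSome (run (init G) s)].

Definition marked_behavior (G : automaton) : set (seq Sigma) :=
  [set s | exists2 x, run (init G) s = Some x & x \in marked G].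

Definition regular (L : set (seq Sigma)) : Prop :=
  exists A : automaton, L = marked_behavior A.

Definition prefix_closure (K : set (seq Sigma)) : set (seq Sigma) :=
  [set s | exists t, K (s ++ t)].

Definition proj (A : {set Sigma}) (s : seq Sigma) : seq Sigma :=
  [seq a <- s | a \in A].

(* [uc] is the set of uncontrollable events; the controllable ones are its
   complement. *)
Definition controllable (G : automaton) (uc : {set Sigma})
    (K : set (seq Sigma)) : Prop :=
  forall s a, prefix_closure K s -> a \in uc ->
    closed_behavior G (rcons s a) -> prefix_closure K (rcons s a).

Definition trans (G : automaton) : Type :=
  {t : state G * Sigma | isSome (delta t.1 t.2)}.

Definition event (G : automaton) (t : trans G) : Sigma := (val t).2.

(* The transitions executed by [s] from [x]; for a string that blocks, those
   executed up to the blocking point (only used for [s] in the closed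
   behavior). *)
Fixpoint executed (G : automaton) (x : state G) (s : seq Sigma) :
    seq (trans G) :=
  if s is a :: s' then
    match (insub (x, a) : option (trans G)), delta x a with
    | Some t, Some y => t :: executed y s'
    | _, _ => [::]
    end
  else [::].

(* What it means for [res] to be a resource map induced by the mutual exclusion
   relation [h], the resource set being ['I_n]. *)
Definition induced_resources (G : automaton) (h : rel Sigma) (n : nat)
    (res : trans G -> {set 'I_n}) : Prop :=
  (forall t u, event t = event u -> res t = res u) /\
  (forall t u, (exists r, (r \in res t) && (r \in res u)) <->
               h (event t) (event u)).

End Automata.

Arguments automaton Sigma : clear implicits.

Section MaxPlus.
Context {R : realType}.

(* The max-plus semiring is the part of [\bar R] that avoids [+oo]: its sum is
   [maxe] with zero [-oo], its product is [adde] with unit [0]. *)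
Definition mp_mul (m n p : nat) (A : 'M[\bar R]_(m, n)) (B : 'M[\bar R]_(n, p)) :
    'M[\bar R]_(m, p) :=
  \matrix_(i, j) \big[maxe/-oo%E]_(k < n) (A i k + B k j)%E.

Definition mp_id (n : nat) : 'M[\bar R]_n :=
  \matrix_(i, j) (if i == j then 0%E else -oo%E).

End MaxPlus.

Section ExecutionTime.
Context {R : realType} {Sigma : finType} {G : automaton Sigma} {n : nat}.
Variables (res : trans G -> {set 'I_n}) (g : trans G -> R).

Definition trans_mx (t : trans G) : 'M[\bar R]_n :=
  \matrix_(q, v)
    if ((q == v) && (q \notin res t)) || ((q \in res t) && (v \notin res t))
    then 0%E
    else if (q \in res t) && (v \in res t) then (g t)%:E
    else -oo%E.

Definition seq_mx (w : seq (trans G)) : 'M[\bar R]_n :=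
  foldr (fun t M => mp_mul (trans_mx t) M) (mp_id n) w.

(* When [n > 0] and every [res t] is nonempty, the product below is a finite
   number, so [fine] loses nothing. *)
Definition exec_time (s : seq Sigma) : R :=
  fine (mp_mul (mp_mul (const_mx 0%E : 'rV_n) (seq_mx (executed (init G) s)))
               (const_mx 0%E : 'cV_n) ord0 ord0).

End ExecutionTime.

Record job (R : realType) (Sigma : finType) := Job {
  job_events : {set Sigma};
  job_lang : set (seq Sigma);
  job_deadline : R }.

Definition wf_job (R : realType) (Sigma : finType) (j : job R Sigma) : Prop :=
  [/\ job_lang j `<=` [set s | all (fun a => a \in job_events j) s],
      regular (job_lang j) & 0 < job_deadline j].

Section Synthesis.
Context {R : realType} {Sigma : finType} {G : automaton Sigma} {n : nat}.
Context {I : finType}.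
Variables (uc : {set Sigma}) (res : trans G -> {set 'I_n}).
Variables (E : set (seq Sigma)) (J : I -> job R Sigma).

(* The prefixes of [s] are the [take k s] with [k <= size s]; the default value
   of the minimum is the one attained at [k = size s]. *)
Definition job_time (g : trans G -> R) (A : {set Sigma}) (s : seq Sigma) : R :=
  \big[Num.min/exec_time res g s]_(k < (size s).+1 | proj A (take k s) == proj A s)
     exec_time res g (take k s).

Definition meets_deadlines (g : trans G -> R) (s : seq Sigma) : Prop :=
  forall i, job_time g (job_events (J i)) s <= job_deadline (J i).

Definition timely (g : trans G -> R) : set (seq Sigma) :=
  [set s | (forall i, job_lang (J i) (proj (job_events (J i)) s)) /\
           meets_deadlines g s].

Definition ctrl_sublangs (g : trans G -> R) : set (set (seq Sigma)) :=
  [set K | K `<=` marked_behavior G `&` E `&` timely g /\ controllable G uc K].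

Definition supC (g : trans G -> R) : set (seq Sigma) :=
  xget set0 [set K | ctrl_sublangs g K /\
                     forall K', ctrl_sublangs g K' -> K' `<=` K].

Definition earliness (g : trans G -> R) (s : seq Sigma) : R :=
  \sum_(i : I) (job_deadline (J i) - job_time g (job_events (J i)) s).

(* The maximum of the earliness over a finite language, and [0] for [set0]. *)
Definition lang_earliness (g : trans G -> R) (K : set (seq Sigma)) : R :=
  xget 0 [set m | [set earliness g s | s in K] m /\
                  ubound [set earliness g s | s in K] m].

Definition supCF (g : trans G -> R) : set (seq Sigma) :=
  xget set0
    [set K | [/\ K !=set0, ctrl_sublangs g K &
      forall K', K' !=set0 -> ctrl_sublangs g K' ->
        lang_earliness g K <= lang_earliness g K' /\
        (lang_earliness g K' = lang_earliness g K -> K' `<=` K)]].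

Definition delays : set (trans G -> R) :=
  [set D | (forall t, 0 <= D t) /\ (forall t, event t \in uc -> D t = 0)].

Definition min_ctrl_sublangs (K : set (seq Sigma)) : set (set (seq Sigma)) :=
  [set K1 | [/\ K1 !=set0, K1 `<=` K, controllable G uc K1 &
    forall K2, K2 !=set0 -> K2 `<=` K -> controllable G uc K2 ->
      K2 `<=` K1 -> K2 = K1]].

Variable f : trans G -> R.

Definition feasible (L : set (seq Sigma)) : set (trans G -> R) :=
  [set D | delays D /\ forall s, L s -> meets_deadlines (f \+ D) s].

Definition opt_value (L : set (seq Sigma)) : R :=
  inf [set lang_earliness (f \+ D) L | D in feasible L].

Definition opt_delays (L : set (seq Sigma)) : set (trans G -> R) :=
  [set D | feasible L D /\ lang_earliness (f \+ D) L = opt_value L].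

Definition opt_langs (K : set (seq Sigma)) : set (set (seq Sigma)) :=
  [set L | min_ctrl_sublangs K L /\
    forall L', min_ctrl_sublangs K L' -> opt_value L <= opt_value L'].

Definition opt_lang_delays (K : set (seq Sigma)) : set (trans G -> R) :=
  \bigcup_(L in opt_langs K) opt_delays L.

End Synthesis.

Definition is_min (R : realType) (A : set R) (m : R) : Prop := A m /\ lbound A m.

(* Main.v *)
(* Since every event belongs to some job, the time of the job of the last event
   of a string is the execution time of the whole string.  Heap heights add up
   to at least the total duration of the executed transitions, so meeting the
   deadlines bounds the length of a string, and K = supC(f) is finite.  Delays
   only increase times, so every language that is timely under f + D is timely
   under f; hence supC(f + D) is contained in K, and the earliness of
   supCF(f + D) is bounded below by that of a minimal controllable sublanguage
   L' of K for which D is feasible, hence by the optimal value of L'.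
   Conversely a language L of least optimal value lies in supC(f + D) for each
   of its optimal delays D, whence equality.  The optimum of a fixed L is
   attained because the feasible delays may be capped at a common bound, after
   which they form a compact set on which the earliness is continuous. *)
Require Import Defs.
From mathcomp Require Import all_boot all_order all_algebra.
From mathcomp Require Import boolp classical_sets reals constructive_ereal.
From mathcomp Require Import finmap functions cardinality.
From mathcomp Require Import topology normedtype derive.

Set Implicit Arguments.
Unset Strict Implicit.
Unset Printing Implicit Defensive.

Import Order.TTheory GRing.Theory Num.Theory.
Import numFieldNormedType.Exports.

Local Open Scope classical_set_scope.
Local Open Scope ring_scope.

(** * Minimizers over finite sets, and finiteness of families of languages *)

Section FiniteExtrema.

Lemma finite_argmin d (V : orderType d) (T : eqType) (A : set T) (F : T -> V) :
  finite_set A -> A !=set0 ->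
  exists2 a, A a & forall b, A b -> (F a <= F b)%O.
Proof.
move=> /finite_seqP[[|x r] ->]; first by case.
move=> _; elim: r x => [x|y r ih x].
  by exists x; rewrite /= ?mem_head// => b; rewrite inE => /eqP->.
have [a /= ar amin] := ih y; have [xa|ax] := leP (F x) (F a).
  exists x; rewrite /= ?mem_head// => b; rewrite inE => /predU1P[->//|/amin].
  exact: le_trans.
exists a; rewrite /= 1?inE ?ar ?orbT// => b.
by rewrite inE => /predU1P[->|/amin//]; exact: ltW.
Qed.

Lemma finite_set_subsets (T : choiceType) (A : set T) :
  finite_set A -> finite_set [set B | B `<=` A].
Proof.
move=> /finite_fsetP[X ->].
have := finite_image (fun Y : {fset T} => [set` Y]) (finite_fset (fpowerset X)).
apply: sub_finite_set => B BX /=.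
have finB : finite_set B by apply: sub_finite_set BX _.
exists (fset_set B); last by rewrite fset_setK.
rewrite /= fpowersetE; apply/fsubsetP => x.
by rewrite in_fset_set// => /set_mem/BX.
Qed.

Lemma finite_set_size_le (T : finType) (N : nat) :
  finite_set [set s : seq T | (size s <= N)%N].
Proof.
have -> : [set s : seq T | (size s <= N)%N] =
    \bigcup_(k in `I_N.+1) range (fun t : k.-tuple T => tval t).
  apply/seteqP; split=> [s sN|_ [k kN [t _ <-]]]; last by rewrite /= size_tuple.
  by exists (size s) => //; exists (in_tuple s).
by apply: bigcup_finite => // k _; apply: finite_image.
Qed.

End FiniteExtrema.

(** * Execution time as the top of a heap of pieces *)

Section HeapModel.
Context {R : realType} {Sigma : finType} {G : automaton Sigma} {n : nat}.
Variable res : trans G -> {set 'I_n}.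
Implicit Types (g : trans G -> R) (w : seq (trans G)).

(* The heap (Tetris) reading of the max-plus matrices: [height g w q] is the
   largest entry of row [q] of [seq_mx res g w], which unlike the individual
   entries is always finite. *)
Fixpoint height g w (q : 'I_n) : R :=
  if w is t :: w' then
    let piece k := (if k \in res t then g t else 0) + height g w' k in
    if q \in res t then \big[Num.max/piece q]_k piece k else height g w' q
  else 0.

(** A maximum of reals has no neutral initial value to play the part of [-oo], so the value at some
    index [q] is used and then absorbed. *)
Lemma bigmaxe_EFin (q : 'I_n) (F : 'I_n -> R) :
  \big[maxe/-oo%E]_k (F k)%:E = (\big[Num.max/F q]_k F k)%:E.
Proof.
rewrite -EFin_bigmax; apply/le_anti/andP; split.
  by apply: bigmax_le => [|k _]; rewrite ?leNye// le_bigmax.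
by apply: bigmax_le => [|k _]; exact: (le_bigmax _ (fun k => (F k)%:E)).
Qed.

(** After the two maxima are exchanged, the row maximum of a product needs only the row maxima of
    its right factor. A row [q] outside [res t] has the diagonal 0 as its only finite entry; a row
    in [res t] has no entry [-oo]. *)
Lemma bigmax_seq_mx g w q :
  \big[maxe/-oo%E]_k seq_mx res g w q k = (height g w q)%:E.
Proof.
elim: w q => [|t w ih] q /=.
  apply/le_anti/andP; split.
    by apply: bigmax_le => [|k _]; rewrite ?leNye// mxE; case: ifP;
      rewrite ?leNye.
  by apply: (bigmax_sup q); rewrite // mxE eqxx.
under eq_bigr do rewrite mxE.
rewrite exchange_big /=.
under eq_bigr => j _.
  rewrite -(big_morph (fun y => trans_mx res g t q j + y)%E
    (adde_maxr _) (addeNy _)) ih mxE.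
  over.
case: ifPn => qt /=; last first.
  apply/le_anti/andP; split.
    apply: bigmax_le => [|k _]; rewrite ?leNye//.
    by case: eqP => [->|]; rewrite ?add0e//= addNye leNye.
  by apply: (bigmax_sup q); rewrite // eqxx add0e.
rewrite -(bigmaxe_EFin q); apply: eq_bigr => k _; rewrite andbF /=.
by case: (k \in res t); rewrite /= ?add0r ?EFinD ?add0e.
Qed.

Lemma exec_timeE (q : 'I_n) g s :
  let w := executed (init G) s in
  exec_time res g s = \big[Num.max/height g w q]_k height g w k.
Proof.
rewrite /= /exec_time mxE.
under [in LHS]eq_bigr => k _.
  rewrite !mxE adde0; under eq_bigr do rewrite mxE add0e.
  over.
rewrite exchange_big /=; under [in LHS]eq_bigr do rewrite bigmax_seq_mx.
by rewrite (bigmaxe_EFin q).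
Qed.

Lemma height_le g g' w q : (forall t, g t <= g' t) ->
  height g w q <= height g' w q.
Proof.
move=> gg'; elim: w q => //= t w ih q; case: ifP => // qt.
have piece_le k : (if k \in res t then g t else 0) + height g w k <=
                  (if k \in res t then g' t else 0) + height g' w k.
  by rewrite lerD//; case: ifP.
apply: bigmax_le => [|k _]; first by apply: (bigmax_sup q).
by apply: (bigmax_sup k).
Qed.

Lemma eq_height g g' w q : {in w, g =1 g'} -> height g w q = height g' w q.
Proof.
elim: w q => //= t w ih q gg'.
have {}ih k : height g w k = height g' w k.
  by apply: ih => u uw; rewrite gg'// inE uw orbT.
rewrite ih gg' ?mem_head//; case: ifP => // qt.
by rewrite qt; apply: eq_bigr => k _; rewrite ih.
Qed.

Lemma exec_time_le g g' s : (0 < n)%N -> (forall t, g t <= g' t) ->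
  exec_time res g s <= exec_time res g' s.
Proof.
move=> n0 gg'; rewrite !(exec_timeE (Ordinal n0)).
by apply: bigmax_le => [|k _];
  [apply: (bigmax_sup (Ordinal n0))|apply: (bigmax_sup k)] => //;
  exact: height_le.
Qed.

Lemma eq_exec_time g g' s : (0 < n)%N ->
  {in executed (init G) s, g =1 g'} -> exec_time res g s = exec_time res g' s.
Proof.
move=> n0 gg'; rewrite !(exec_timeE (Ordinal n0)) /=.
rewrite (eq_height (Ordinal n0) gg').
by congr bigop; apply/funext => k; rewrite (eq_height k gg').
Qed.

(** Each transition [t] raises the height at a chosen resource [p] of [res t] by at least [g t] and
    lowers no other height. *)
Lemma sum_height_ge g w :
  (forall t, 0 <= g t) -> (forall t, res t != finset.set0) ->
  \sum_(t <- w) g t <= \sum_q height g w q.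
Proof.
move=> g0 res0; elim: w => [|t w ih].
  by rewrite big_nil; apply: sumr_ge0.
have /set0Pn[p pt] := res0 t.
have le_piece q : (if q == p then g t else 0) + height g w q <=
    height g (t :: w) q.
  rewrite /=; have [qt|qt] := boolP (q \in res t); last first.
    by case: eqP qt => [->|_ _]; rewrite ?pt// add0r.
  by apply: (bigmax_sup q); rewrite // qt lerD2r; case: ifP.
apply: le_trans (ler_sum _ (fun q _ => le_piece q)).
by rewrite big_split -big_mkcond big_pred1_eq big_cons lerD2l.
Qed.

Lemma sum_exec_time_ge g s : (0 < n)%N ->
  (forall t, 0 <= g t) -> (forall t, res t != finset.set0) ->
  \sum_(t <- executed (init G) s) g t <= exec_time res g s *+ n.
Proof.
move=> n0 g0 res0; apply: le_trans (sum_height_ge _ g0 res0) _.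
rewrite (exec_timeE (Ordinal n0)) -[X in _ *+ X]card_ord -sumr_const.
by apply: ler_sum => q _; exact: le_bigmax.
Qed.

End HeapModel.

(** * Runs, prefixes and projections *)

Section Strings.
Context {Sigma : finType}.
Implicit Type G : automaton Sigma.

Lemma marked_closed_behavior G : marked_behavior G `<=` closed_behavior G.
Proof. by move=> s [x]; rewrite /closed_behavior /= => ->. Qed.

Lemma size_executed G (x : state G) s :
  isSome (run x s) -> size (executed x s) = size s.
Proof.
elim: s x => //= a s ih x; case E : (delta x a) => [y|] //= rs.
by rewrite insubT /= ?E // => _; rewrite /= ih.
Qed.

Lemma executed_take G (x : state G) s k :
  {subset executed x (take k s) <= executed x s}.
Proof.
elim: s x k => [|a s ih] x [|k] //= t; case: insub => // u.
by case: (delta x a) => // y; rewrite !inE => /predU1P[->|/ih->];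
  rewrite ?eqxx ?orbT.
Qed.

Lemma proj_take_rcons (A : {set Sigma}) s a k : a \in A ->
  proj A (take k (rcons s a)) = proj A (rcons s a) ->
  take k (rcons s a) = rcons s a.
Proof.
move=> aA; have [ks|sk] := leqP k (size s); last first.
  by rewrite take_oversize ?size_rcons.
rewrite -cats1 takel_cat// /proj filter_cat /= aA => /(congr1 size).
rewrite size_cat /=.
rewrite -[X in _ = (size (seq.filter _ X) + _)%N](cat_take_drop k s).
rewrite filter_cat size_cat -addnA -[LHS]addn0 => /eqP.
by rewrite eqn_add2l addn1.
Qed.

End Strings.

(** * Job times, and finiteness of the strings that meet the deadlines *)

Section JobTime.
Context {R : realType} {Sigma : finType} {G : automaton Sigma} {n : nat}.
Variable res : trans G -> {set 'I_n}.
Hypothesis n_gt0 : (0 < n)%N.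
Implicit Types (g : trans G -> R) (A : {set Sigma}) (s : seq Sigma).

Lemma job_time_le g g' A s : (forall t, g t <= g' t) ->
  job_time res g A s <= job_time res g' A s.
Proof.
move=> gg'; apply: le_bigmin => [|k ks].
  by apply: le_trans (bigmin_le_id _ _ _ _) _; exact: exec_time_le.
by apply: (bigmin_inf k) => //; exact: exec_time_le.
Qed.

Lemma eq_job_time g g' A s : {in executed (init G) s, g =1 g'} ->
  job_time res g A s = job_time res g' A s.
Proof.
move=> gg'; rewrite /job_time (eq_exec_time _ _ gg')//; apply: eq_bigr => k _.
by apply: eq_exec_time => // t /executed_take; exact: gg'.
Qed.

(* A proper prefix of [rcons s a] misses the event [a] of [A], so the whole
   string is the only candidate in the minimum. *)
Lemma job_time_rcons g A s a : a \in A ->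
  job_time res g A (rcons s a) = exec_time res g (rcons s a).
Proof.
move=> aA; apply: bigmin_eq_id => k /eqP Pk.
by rewrite (proj_take_rcons aA Pk).
Qed.

Context {I : finType}.
Variable J : I -> job R Sigma.
Hypothesis deadline_ge0 : forall i, 0 <= job_deadline (J i).
Hypothesis jobs_cover : forall a : Sigma, exists i, a \in job_events (J i).

Lemma meets_deadlines_le g g' s : (forall t, g t <= g' t) ->
  meets_deadlines res J g' s -> meets_deadlines res J g s.
Proof. by move=> gg' ds i; apply: le_trans (ds i); exact: job_time_le. Qed.

Lemma exec_time_le_deadlines g s : meets_deadlines res J g s ->
  exec_time res g s <= \sum_i job_deadline (J i).
Proof.
case/lastP: s => [_|s a ds].
  (* The empty string has no last event, but all its heights are 0. *)
  rewrite (exec_timeE _ (Ordinal n_gt0)) /= bigmax_eq_id//.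
  exact: sumr_ge0.
have [i ai] := jobs_cover a.
rewrite -(job_time_rcons _ _ ai); apply: le_trans (ds i) _.
by rewrite (bigD1 i)//= lerDl sumr_ge0.
Qed.

Hypothesis res_neq0 : forall t, res t != finset.set0.

Lemma finite_meets_deadlines g : (forall t, 0 < g t) ->
  finite_set (closed_behavior G `&` meets_deadlines res J g).
Proof.
(* The default 1 keeps [c] positive even if there are no transitions. Then [size s * c] is at most
   the total duration of [s], hence at most [n] times the sum of the deadlines. *)
move=> g0; pose c : R := \big[Num.min/1]_t g t.
have c0 : 0 < c by apply: lt_bigmin.
pose B := (\sum_i job_deadline (J i)) *+ n / c.
have B0 : 0 <= B by rewrite divr_ge0 ?mulrn_wge0 ?sumr_ge0// ltW.
apply: sub_finite_set (finite_set_size_le Sigma (Num.bound B)).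
move=> s [cs ds] /=; rewrite -(ler_nat R); apply: ltW.
apply: le_lt_trans (archi_boundP B0); rewrite ler_pdivlMr//.
rewrite -(size_executed cs) mulr_natl.
have := sum_exec_time_ge s n_gt0 (fun t => ltW (g0 t)) res_neq0.
move=> sum_le; have := exec_time_le_deadlines ds.
move=> /(ler_wMn2r n)/(le_trans sum_le); apply: le_trans.
rewrite -count_predT -iter_addr_0 -big_const_seq.
by apply: ler_sum => t _; exact: bigmin_le.
Qed.

End JobTime.

(** * Minimal and supremal controllable sublanguages *)

(** A nonempty controllable sublanguage of [M] with the fewest strings is minimal for inclusion, and
    its competitors in [K] lie below it, hence in [M]. *)
Lemma exists_min_ctrl_sublang (Sigma : finType) (G : automaton Sigma)
    (uc : {set Sigma}) (K M : set (seq Sigma)) :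
  finite_set M -> M !=set0 -> M `<=` K -> controllable G uc M ->
  exists2 L, min_ctrl_sublangs (G := G) uc K L & L `<=` M.
Proof.
move=> finM M0 MK cM.
pose C := [set L | [/\ L !=set0, L `<=` M & controllable G uc L]].
have finC : finite_set C.
  by apply: sub_finite_set (finite_set_subsets finM) => L [].
have [|L [L0 LM cL] Lmin] :=
  finite_argmin (fun L => #|` fset_set L|) finC.
  by exists M; split.
exists L => //; split=> // [|L2 L20 _ cL2 L2L]; first exact: subset_trans MK.
have finL := sub_finite_set LM finM.
have finL2 := sub_finite_set L2L finL.
have /eqP : fset_set L2 == fset_set L.
  rewrite eqEfcard; apply/andP; split; first by rewrite -fset_set_sub.
  by rewrite -leEnat; apply: Lmin; split=> //; exact: subset_trans LM.
exact: fset_set_inj.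
Qed.

Section ControllableSublanguages.
Context {R : realType} {Sigma : finType} {G : automaton Sigma} {n : nat}.
Context {I : finType}.
Variables (uc : {set Sigma}) (res : trans G -> {set 'I_n}).
Variables (E : set (seq Sigma)) (J : I -> job R Sigma).
Implicit Types (g : trans G -> R) (K L M : set (seq Sigma)).

Lemma lang_earlinessP g K : finite_set K -> K !=set0 ->
  [set earliness res J g s | s in K] (lang_earliness res J g K) /\
  ubound [set earliness res J g s | s in K] (lang_earliness res J g K).
Proof.
move=> finK K0; apply: (@xgetPex _ 0
  [set m | [set earliness res J g s | s in K] m /\
           ubound [set earliness res J g s | s in K] m]).
have [s Ks smax] := finite_argmin (fun s => - earliness res J g s) finK K0.
exists (earliness res J g s); split; first by exists s.
by move=> _ [t Kt <-]; rewrite -lerN2; exact: smax.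
Qed.

Lemma lang_earliness_le g K M : finite_set M -> K !=set0 -> K `<=` M ->
  lang_earliness res J g K <= lang_earliness res J g M.
Proof.
move=> finM K0 KM.
have [[s Ks <-] _] := lang_earlinessP g (sub_finite_set KM finM) K0.
have [_ +] := lang_earlinessP g finM (subset_nonempty KM K0).
by apply; exists s => //; exact: KM.
Qed.

(** A prefix of a string of the union is a prefix within a single member, whose own controllability
    provides the extension. *)
Lemma ctrl_sublangs_bigcup g (F : set (set (seq Sigma))) :
  F `<=` ctrl_sublangs uc res E J g ->
  ctrl_sublangs uc res E J g (\bigcup_(K in F) K).
Proof.
move=> FC; split=> [s [K FK Ks]|s a [t [K FK Kst]] auc csa].
  by have [+ _] := FC _ FK; apply.
have [_ /(_ s a)[|//|//|u Ku]] := FC _ FK; first by exists t.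
by exists u, K.
Qed.

Lemma supCP g : ctrl_sublangs uc res E J g (supC uc res E J g) /\
  forall K, ctrl_sublangs uc res E J g K -> K `<=` supC uc res E J g.
Proof.
apply: (@xgetPex _ set0 [set K | ctrl_sublangs uc res E J g K /\
  forall K', ctrl_sublangs uc res E J g K' -> K' `<=` K]).
exists (\bigcup_(K in ctrl_sublangs uc res E J g) K); split.
  exact: ctrl_sublangs_bigcup.
by move=> K CK s Ks; exists K.
Qed.

(** There are finitely many candidates, so some [L] has least earliness. The union [U] of all
    candidates with that earliness is then the supremal one, which shows that the [xget] in [supCF]
    is not its default. *)
Lemma supCFP g : finite_set (supC uc res E J g) -> supC uc res E J g !=set0 ->
  let M := supCF uc res E J g in
  [/\ M !=set0, ctrl_sublangs uc res E J g M &
    forall K, K !=set0 -> ctrl_sublangs uc res E J g K ->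
      lang_earliness res J g M <= lang_earliness res J g K].
Proof.
move=> finS S0; have [CS Smax] := supCP g.
pose C := [set K | K !=set0 /\ ctrl_sublangs uc res E J g K].
have finC : finite_set C.
  by apply: sub_finite_set (finite_set_subsets finS) => K [_ /Smax].
have [|L [L0 CL] Lmin] := finite_argmin (lang_earliness res J g) finC.
  by exists (supC uc res E J g).
pose F := C `&` [set K | lang_earliness res J g K = lang_earliness res J g L].
pose U := \bigcup_(K in F) K.
have CU : ctrl_sublangs uc res E J g U.
  by apply: ctrl_sublangs_bigcup => K [[]].
have LU : L `<=` U by move=> s Ls; exists L.
have U0 : U !=set0 by exact: subset_nonempty L0.
have finU : finite_set U by apply: sub_finite_set finS; exact: Smax.
(* The maximum over [U] is attained at a string of some member [K], so it does not exceed the common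
   earliness. *)
have eU : lang_earliness res J g U = lang_earliness res J g L.
  apply/le_anti; rewrite (lang_earliness_le g finU L0 LU) andbT.
  have [[s [K [[K0 CK] eK] Ks] <-] _] := lang_earlinessP g finU U0.
  have finK := sub_finite_set (Smax _ CK) finS.
  rewrite -eK; have [_ +] := lang_earlinessP g finK K0.
  by apply; exists s.
suff [M0 CM Mmin] : [set K | [/\ K !=set0, ctrl_sublangs uc res E J g K &
    forall K', K' !=set0 -> ctrl_sublangs uc res E J g K' ->
      lang_earliness res J g K <= lang_earliness res J g K' /\
      (lang_earliness res J g K' = lang_earliness res J g K -> K' `<=` K)]]
    (supCF uc res E J g).
  by split=> // K K0 /(Mmin _ K0)[].
apply: xgetPex; exists U; split=> // K K0 CK; rewrite eU.
by split=> [|eK s Ks]; [exact: Lmin|exists K].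
Qed.

End ControllableSublanguages.

(** * Continuity of iterated maxima, minima and sums *)

Section Continuity.
Context {R : realType} {T : topologicalType}.

(* Unlike in [continuous_big], the initial value of the iteration varies. *)
Lemma continuous_big_idx (I : Type) (op : R -> R -> R) (F0 : T -> R)
    (F : I -> T -> R) (r : seq I) (P : pred I) :
  (forall u v : T -> R, continuous u -> continuous v ->
     continuous (fun x => op (u x) (v x))) ->
  continuous F0 -> (forall i, continuous (F i)) ->
  continuous (fun x => \big[op/F0 x]_(i <- r | P i) F i x).
Proof.
move=> cop cF0 cF; elim: r => [|i r ih].
  by under eq_fun do rewrite big_nil.
under eq_fun do rewrite big_cons.
by case: (P i); [exact: cop|exact: ih].
Qed.

Lemma maxr_continuous (u v : T -> R) : continuous u -> continuous v ->
  continuous (fun x => Num.max (u x) (v x)).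
Proof. by move=> cu cv x; apply: (continuous_max (cu x) (cv x)). Qed.

Lemma minr_continuous (u v : T -> R) : continuous u -> continuous v ->
  continuous (fun x => Num.min (u x) (v x)).
Proof. by move=> cu cv x; apply: (continuous_min (cu x) (cv x)). Qed.

Lemma addr_continuous (u v : T -> R) : continuous u -> continuous v ->
  continuous (fun x => u x + v x).
Proof. by move=> cu cv x; apply: cvgD; [exact: cu|exact: cv]. Qed.

End Continuity.

(** * Existence of optimal delays for a fixed language *)

Section OptimalDelays.
Context {R : realType} {Sigma : finType} {G : automaton Sigma} {n : nat}.
Context {I : finType}.
Variables (uc : {set Sigma}) (res : trans G -> {set 'I_n}).
Variables (J : I -> job R Sigma) (f : trans G -> R).
Hypothesis n_gt0 : (0 < n)%N.

(** The product topology makes every evaluation [D t] continuous and gives compact boxes by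
    Tychonoff's theorem. *)
Let T : topologicalType :=
  prod_topology (fun _ : trans G => R : topologicalType).

Lemma height_continuous w q : continuous (fun D : T => height res (f \+ D) w q).
Proof.
elim: w q => [|t w ih] q /=; first exact: cst_continuous.
pose piece k (D : T) :=
  (if k \in res t then f t + D t else 0) + height res (f \+ D) w k.
have cpiece k : continuous (piece k).
  apply: addr_continuous => //; case: (k \in res t); last exact: cst_continuous.
  apply: addr_continuous; first exact: cst_continuous.
  exact: (@proj_continuous _ (fun=> R) t).
case: {1}(q \in res t) => //.
apply: (@continuous_big_idx _ _ _ _ (piece q) piece) => //.
exact: maxr_continuous.
Qed.

Lemma exec_time_continuous s :
  continuous (fun D : T => exec_time res (f \+ D) s).
Proof.
under eq_fun do rewrite (exec_timeE _ (Ordinal n_gt0)).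
pose h k (D : T) := height res (f \+ D) (executed (init G) s) k.
apply: (@continuous_big_idx _ _ _ _ (h _) h) => [||k].
  exact: maxr_continuous.
  exact: height_continuous.
exact: height_continuous.
Qed.

Lemma job_time_continuous A s :
  continuous (fun D : T => job_time res (f \+ D) A s).
Proof.
pose e (k : 'I_(size s).+1) (D : T) := exec_time res (f \+ D) (take k s).
apply: (@continuous_big_idx _ _ _ _ _ e) => [||k]; first exact: minr_continuous.
  exact: exec_time_continuous.
exact: exec_time_continuous.
Qed.

Lemma earliness_continuous s :
  continuous (fun D : T => earliness res J (f \+ D) s).
Proof.
pose e i (D : T) :=
  job_deadline (J i) - job_time res (f \+ D) (job_events (J i)) s.
apply: (@continuous_big_idx _ _ _ _ (fun=> 0) e) => [||i D].
- exact: addr_continuous.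
- exact: cst_continuous.
- apply: (@continuousB _ _ _ (fun=> _)
    (fun D : T => job_time res (f \+ D) _ s)).
    exact: cst_continuous.
  exact: job_time_continuous.
Qed.

Lemma lang_earliness_continuous L : finite_set L -> L !=set0 ->
  continuous (fun D : T => lang_earliness res J (f \+ D) L).
Proof.
move=> finL L0; have /finite_seqP[[|s r] eL] := finL.
  by move: L0; rewrite eL => -[].
pose e u (D : T) := earliness res J (f \+ D) u.
(* Listing the finite language rewrites the [xget] as an iterated maximum, whose initial value
   [e s D] varies with [D]. *)
have eE : (fun D : T => lang_earliness res J (f \+ D) L) =
    (fun D : T => \big[Num.max/e s D]_(u <- s :: r) e u D).
  apply/funext => D.
  have [[u Lu <-] ub] := lang_earlinessP res J (f \+ D) finL L0.
  apply/le_anti/andP; split.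
    by move: Lu; rewrite eL => ur; apply: (bigmax_sup_seq _ u).
  rewrite big_seq; apply: bigmax_le => [|v vr]; apply: ub.
    by exists s; rewrite // eL /= mem_head.
  by exists v; rewrite // eL.
rewrite eE; apply: (@continuous_big_idx _ _ _ _ (e s) e) => [||u].
- exact: maxr_continuous.
- exact: earliness_continuous.
- exact: earliness_continuous.
Qed.

Lemma feasible_closed L : closed (feasible uc res J f L : set T).
Proof.
have -> : feasible uc res J f L =
    (\bigcap_t [set D : T | 0 <= D t]) `&`
    (\bigcap_(t in [set t | event t \in uc]) [set D : T | D t = 0]) `&`
    (\bigcap_(s in L) \bigcap_i
      [set D : T | job_time res (f \+ D) (job_events (J i)) s <=
                   job_deadline (J i)]).
  apply/seteqP; split=> [D [[D0 Duc] DL]|D [[D0 Duc] DL]].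
    split=> [|s Ls i _]; last exact: (DL s Ls i).
    by split=> t; [move=> _; exact: D0|exact: Duc].
  split=> [|s Ls i]; last exact: (DL s Ls i).
  by split=> t; [exact: (D0 t)|exact: (Duc t)].
apply: closedI; first apply: closedI.
- apply: closed_bigI => t _.
  apply: (@preimage_closed _ _ (fun D : T => D t) [set x | 0 <= x]);
    last exact: closed_ge.
  by move=> D _; exact: (@proj_continuous _ (fun=> R) t).
- apply: closed_bigI => t _.
  apply: (@preimage_closed _ _ (fun D : T => D t) [set x | x = 0]);
    last exact: closed_eq.
  by move=> D _; exact: (@proj_continuous _ (fun=> R) t).
- apply: closed_bigI => s _; apply: closed_bigI => i _.
  apply: (@preimage_closed _ _
    (fun D : T => job_time res (f \+ D) (job_events (J i)) s)
    [set x | x <= job_deadline (J i)]); last exact: closed_le.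
  by move=> D _; exact: job_time_continuous.
Qed.

Hypothesis f_ge0 : forall t, 0 <= f t.
Hypothesis res_neq0 : forall t, res t != finset.set0.
Hypothesis deadline_ge0 : forall i, 0 <= job_deadline (J i).
Hypothesis jobs_cover : forall a : Sigma, exists i, a \in job_events (J i).

(** On a string that meets the deadlines, the heap inequality bounds the sum of all weights by this
    number, hence each single delay as well. *)
Let bound : R := (\sum_i job_deadline (J i)) *+ n.

Lemma feasible_executed_le L D s t : feasible uc res J f L D -> L s ->
  t \in executed (init G) s -> D t <= bound.
Proof.
move=> [[D0 _] DL] Ls ts.
have fD0 u : 0 <= (f \+ D) u by rewrite addr_ge0.
have := exec_time_le_deadlines n_gt0 deadline_ge0 jobs_cover (DL _ Ls).
move=> /(ler_wMn2r n)/(le_trans (sum_exec_time_ge s n_gt0 fD0 res_neq0)).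
apply: le_trans; rewrite (big_rem t)//=.
by apply: ler_wpDr; [apply: sumr_ge0 => u _; exact: fD0|rewrite lerDr].
Qed.

Lemma eq_earliness (g g' : trans G -> R) s :
  {in executed (init G) s, g =1 g'} ->
  earliness res J g s = earliness res J g' s.
Proof.
by move=> gg'; apply: eq_bigr => i _; rewrite (eq_job_time _ n_gt0 _ gg').
Qed.

(* Only the transitions executed by [L] matter and their feasible delays are
   at most [bound], so capping all delays at [bound] changes nothing on [L] and
   lets compactness apply. *)
Lemma feasible_truncate L D : feasible uc res J f L D ->
  let D' := fun t => Num.min (D t) bound in
  [/\ feasible uc res J f L D', forall t, 0 <= D' t <= bound &
    lang_earliness res J (f \+ D') L = lang_earliness res J (f \+ D) L].
Proof.
move=> fD D'; have [[D0 Duc] DL] := fD.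
have bound_ge0 : 0 <= bound by rewrite mulrn_wge0 ?sumr_ge0.
have D'0 t : 0 <= D' t by rewrite le_min D0.
have D'E s : L s -> {in executed (init G) s, f \+ D' =1 f \+ D}.
  move=> Ls t ts; congr (_ + _); apply/min_idPl.
  exact: feasible_executed_le fD Ls ts.
split.
(* Since [bound] is nonnegative, capping leaves the zero delays of uncontrollable events at zero. *)
- split; first by split=> // t /Duc Dt; rewrite /D' Dt min_l.
  by move=> s Ls i; rewrite (eq_job_time _ n_gt0 _ (D'E _ Ls)); exact: DL.
- by move=> t; rewrite D'0 ge_min lexx orbT.
- rewrite /lang_earliness.
  suff -> : [set earliness res J (f \+ D') s | s in L] =
            [set earliness res J (f \+ D) s | s in L] by [].
  by apply: eq_imagel => s Ls; exact: eq_earliness (D'E _ Ls).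
Qed.

Lemma opt_delays_nonempty L : finite_set L -> L !=set0 ->
  feasible uc res J f L !=set0 -> opt_delays uc res J f L !=set0.
Proof.
move=> finL L0 [D1 fD1].
pose box := [set D : T | forall t, `[0, bound]%classic (D t)].
have cbox : compact box.
  apply: (@tychonoff _ (fun=> R) (fun=> `[0, bound]%classic)) => t.
  exact: segment_compact.
have cS := compact_closedI cbox (@feasible_closed L).
pose e (D : T) := lang_earliness res J (f \+ D) L.
have ce : continuous e by exact: lang_earliness_continuous.
have [|D0 /set_mem[_ fD0] D0min] :=
  compact_EVT_min _ cS (continuous_subspaceT ce).
  have [fD' D'b _] := feasible_truncate fD1; eexists; split; last exact: fD'.
  by [].
exists D0; split=> //.
(* Truncation moves any feasible [D] into the box without changing its value, so the minimum over
   the box is global and the infimum is attained at [D0]. *)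
have lb D : feasible uc res J f L D -> e D0 <= e D.
  move=> fD; have [fD' D'b eD'] := feasible_truncate fD.
  rewrite /e -eD'; apply/D0min/mem_set; split=> //.
apply/le_anti/andP; split.
  by apply: lb_le_inf; [exists (e D0), D0|move=> _ [D fD <-]; exact: lb].
by apply: ge_inf; [exists (e D0) => _ [D fD <-]; exact: lb|exists D0].
Qed.

End OptimalDelays.

Theorem theorem2 (R : realType) (Sigma : finType) (uc : {set Sigma})
  (G : automaton Sigma)
  (f : trans G -> R) (hf : forall t, 0 < f t)
  (h : rel Sigma) (h_refl : reflexive h) (h_sym : symmetric h)
  (n : nat) (n_gt0 : (0 < n)%N)
  (res : trans G -> {set 'I_n}) (hres : induced_resources h res)
  (E : set (seq Sigma))
  (I : finType) (J : I -> job R Sigma) (hJ : forall i, wf_job (J i))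
  (hcover : forall a : Sigma, exists i, a \in job_events (J i))
  (hK : supC uc res E J f !=set0) :
  let DCstar := opt_lang_delays uc res J f (supC uc res E J f) in
  DCstar !=set0 /\
  forall Dstar, DCstar Dstar ->
    supC uc res E J (f \+ Dstar) !=set0 /\
    is_min
      [set lang_earliness res J (f \+ D) (supCF uc res E J (f \+ D))
         | D in [set D | delays uc D /\ supC uc res E J (f \+ D) !=set0]]
      (lang_earliness res J (f \+ Dstar) (supCF uc res E J (f \+ Dstar))).
Proof.
have deadline_ge0 i : 0 <= job_deadline (J i) by have [_ _ /ltW] := hJ i.
(* Reflexivity of [h] makes [res t] meet itself. *)
have res_neq0 t : res t != finset.set0.
  have [_ /(_ t t)[_ /(_ (h_refl _))[r]]] := hres.
  by rewrite andbb => rt; apply/set0Pn; exists r.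
have f_ge0 t : 0 <= f t by exact: ltW.
pose K := supC uc res E J f.
have [[K_sub cK] Kmax] := supCP uc res E J f.
have finK : finite_set K.
  apply: sub_finite_set
    (finite_meets_deadlines n_gt0 deadline_ge0 hcover res_neq0 hf).
  by move=> s /K_sub[[/marked_closed_behavior cs _] [_ ds]].
have le_delay D : delays uc D -> forall t, f t <= (f \+ D) t.
  by move=> [D0 _] t; rewrite lerDl.
(* Only the deadline condition depends on the weights, and it weakens as the weights decrease. *)
have ctrl_le D L : delays uc D -> ctrl_sublangs uc res E J (f \+ D) L ->
    ctrl_sublangs uc res E J f L.
  move=> dD [Lsub cL]; split=> // s /Lsub[mEs [ls ds]]; split=> //; split=> //.
  by apply: (meets_deadlines_le n_gt0 (le_delay _ dD)); exact: ds.
have sub_supC D : delays uc D -> supC uc res E J (f \+ D) `<=` K.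
  move=> dD; apply/Kmax/(ctrl_le _ _ dD).
  by have [] := supCP uc res E J (f \+ D).
have feasible_le D L : delays uc D -> ctrl_sublangs uc res E J (f \+ D) L ->
    feasible uc res J f L D.
  by move=> dD [Lsub _]; split=> // s /Lsub[_ []].
have opt_le L D : L !=set0 -> L `<=` K -> feasible uc res J f L D ->
    opt_value uc res J f L <= lang_earliness res J (f \+ D) L.
  move=> L0 LK fD; apply: ge_inf; last by exists D.
  (* Feasibility makes every summand of the earliness nonnegative, so 0 is a lower bound and the
     infimum is a genuine one. *)
  exists 0 => _ [D' [dD' D'L] <-].
  have finL := sub_finite_set LK finK.
  have [[s Ls <-] _] := lang_earlinessP res J (f \+ D') finL L0.
  by apply: sumr_ge0 => i _; rewrite subr_ge0 D'L.
pose CL := min_ctrl_sublangs (G := G) uc K.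
have finCL : finite_set CL.
  by apply: sub_finite_set (finite_set_subsets finK) => L [].
split.
  have [L0 CL0 _] := exists_min_ctrl_sublang finK hK (@subset_refl _ K) cK.
  have [|L CL_L Lmin] := finite_argmin (opt_value uc res J f) finCL.
    by exists L0.
  have [Lne LK cL _] := CL_L.
  have finL := sub_finite_set LK finK.
  (* The zero delay is feasible, because the strings of [K] already meet the deadlines under [f]. *)
  have [D optD] : opt_delays uc res J f L !=set0.
    apply: opt_delays_nonempty => //; exists (fun=> 0).
    apply: feasible_le => //.
    have -> : f \+ (fun=> 0) = f by apply/funext => t /=; rewrite addr0.
    by split=> // s /LK/K_sub.
  by exists D, L.
move=> Dstar [L [CL_L Lmin] [[dDs DsL] eDs]].
have [Lne LK cL _] := CL_L.
have CLs : ctrl_sublangs uc res E J (f \+ Dstar) L.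
  split=> // s Ls; have [mEs [ls _]] := K_sub _ (LK _ Ls).
  by split=> //; split=> // i; exact: DsL.
have S0 : supC uc res E J (f \+ Dstar) !=set0.
  apply: subset_nonempty Lne.
  by have [_] := supCP uc res E J (f \+ Dstar); apply.
split=> //; split; first by exists Dstar.
move=> _ [D [dD SD0] <-].
have supCF_spec D' : delays uc D' -> supC uc res E J (f \+ D') !=set0 -> _ :=
  fun dD' => supCFP (sub_finite_set (sub_supC _ dD') finK).
(* [L] competes in the definition of [supCF] at [f \+ Dstar], so its earliness is an upper bound. *)
have [_ _ /(_ _ Lne CLs)] := supCF_spec _ dDs S0.
have [M0 CM _] := supCF_spec _ dD SD0.
set M := supCF uc res E J (f \+ D) in M0 CM *.
have MK : M `<=` K by exact/Kmax/(ctrl_le _ _ dD).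
have finM := sub_finite_set MK finK.
have [L' CL' L'M] := exists_min_ctrl_sublang finM M0 MK CM.2.
have [L'0 L'K cL' _] := CL'.
(* The earliness of [L] under [f \+ Dstar] is its optimal value, which is at most that of [L'],
   hence at most the earliness of [L'] under [f \+ D], and so of [M]. *)
move=> /le_trans; apply; rewrite eDs; apply: le_trans (Lmin _ CL') _.
apply: le_trans (lang_earliness_le _ _ _ finM L'0 L'M); apply: opt_le => //.
by apply: feasible_le => //; split=> // s /L'M; have [+ _] := CM; apply.
Qed.
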